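(* If $G$ is an Eulerian ribbon graph (embedded graph), then there is a subset $I\subseteq E(G)$ such that the partial Petrial $G^{\tau(I)}$ is checkerboard colourable.
   Context: A ribbon graph $G$ is a surface with boundary built from vertex discs and edge discs, each edge disc meeting vertex discs in exactly two disjoint segments; it is equivalent to a cellularly embedded graph, whose faces are the boundary components of the ribbon graph. $G$ is Eulerian if every vertex has even degree. For an edge $e$, removing from $\partial e$ its two segments of intersection with vertices leaves two arcs (edge line segments); $G$ is checkerboard colourable if the faces can be coloured red/blue so that for each edge the faces containing its two edge line segments get different colours. For $A\subseteq E(G)$, the partial Petrial $G^{\tau(A)}$ is obtained from $G$ by adding a half-twist to each edge in $A$. *)

(* Defs.v *)
From mathcomp Require Import all_boot.

Set Implicit Arguments.
Unset Strict Implicit.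
Unset Printing Implicit Defensive.

(* An edge disc [e] meets the vertex discs in two disjoint segments, its ends
   [(e, i)]; each end has two endpoints [(e, i, s)], the corners of the disc. *)
Definition edge_end (E : finType) : finType := (E * bool)%type.
Definition corner (E : finType) : finType := (edge_end E * bool)%type.

Definition across (E : finType) (x : corner E) : corner E := (x.1, ~~ x.2).

(* The boundary circle of a vertex disc that meets some edge disc is cut by the
   corners lying on it into the ends [x -- across x] attached to the vertex
   and the complementary arcs [x -- arc x]; [attach_arc] says that the corners
   at a given vertex form one such circle.  A vertex outside the image of
   [attach] is an isolated disc.
   The two edge line segments of [e] join the corners of its first end to those
   of its second end, preserving the labels of the corners if [twist e] is
   false and exchanging them if [twist e] is true.  The surface need be neither
   connected nor orientable. *)
Record ribbon_graph := RibbonGraph {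
  vertex : finType;
  edge : finType;
  attach : edge_end edge -> vertex;
  arc : corner edge -> corner edge;
  twist : edge -> bool;
  arcK : involutive arc;
  arc_neq : forall x, arc x != x;
  attach_arc : forall x y : corner edge,
    connect [rel u v | (v == across u) || (v == arc u)] x y
      = (attach x.1 == attach y.1)
}.

(* A loop contributes two ends, hence counts twice. *)
Definition degree (G : ribbon_graph) (v : vertex G) : nat :=
  #|[set h : edge_end (edge G) | attach h == v]|.

Definition eulerian (G : ribbon_graph) : Prop :=
  forall v : vertex G, ~~ odd (degree v).

(* The other corner of the edge line segment through [x]. *)
Definition along (G : ribbon_graph) (x : corner (edge G)) : corner (edge G) :=
  let: (e, i, s) := x in (e, ~~ i, s (+) twist e).

(* The boundary of the surface consists of the edge line segments and the
   vertex arcs, together with the whole boundary of each isolated vertex. *)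
Definition boundary_step (G : ribbon_graph) : rel (corner (edge G)) :=
  [rel x y | (y == along x) || (y == arc x)].

Definition boundary_circles (G : ribbon_graph) : {set {set corner (edge G)}} :=
  equivalence_partition (connect (@boundary_step G)) [set: corner (edge G)].

Definition face (G : ribbon_graph) : finType :=
  ({C : {set corner (edge G)} | C \in boundary_circles G}
   + {v : vertex G | degree v == 0})%type.

Definition boundary_circle (G : ribbon_graph) (x : corner (edge G)) :=
  [set y in [set: corner (edge G)] | connect (@boundary_step G) x y].

Lemma boundary_circleP (G : ribbon_graph) (x : corner (edge G)) :
  boundary_circle x \in boundary_circles G.
Proof. by apply: imset_f; rewrite inE. Qed.

(* The face containing the edge line segment of [e] that starts at the corner
   [(e, false, s)]; the two edge line segments are given by the two [s]. *)
Definition side_face (G : ribbon_graph) (e : edge G) (s : bool) : face G :=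
  inl (exist _ (boundary_circle (e, false, s)) (boundary_circleP (e, false, s))).

Definition checkerboard_colourable (G : ribbon_graph) : Prop :=
  exists colour : face G -> bool,
    forall e : edge G, colour (side_face e false) != colour (side_face e true).

Definition partial_petrial (G : ribbon_graph) (A : {set edge G}) : ribbon_graph :=
  @RibbonGraph (vertex G) (edge G) (@attach G) (@arc G)
    (fun e => twist e (+) (e \in A)) (@arcK G) (@arc_neq G) (@attach_arc G).

(* Main.v *)
Require Import Defs.
From mathcomp Require Import all_boot.

Set Implicit Arguments.
Unset Strict Implicit.
Unset Printing Implicit Defensive.

(** Walk around the boundary circle of a vertex disc: it passes alternately
    through edge ends and complementary arcs, with as many ends as the degree of
    the vertex.  When the degree is even, the corners on the circle can be
    2-coloured so that the colour changes across every end and is constant on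
    every arc.  An edge line segment may join corners of different colours, but
    as the two corners of each end have different colours this happens for both
    segments of an edge or for neither, and a half-twist repairs it.  After
    twisting the bad edges, the corner colouring is constant on faces and
    differs on the two sides of each edge. *)

(** Each step raises the index by one, except the last, which wraps from [order g r - 1] to 0;
    evenness of the order makes the parity flip there too. *)
Lemma odd_findex_next (T : finType) (g : T -> T) r y : injective g -> ~~ odd (order g r) ->
  fconnect g r y -> odd (findex g r (g y)) = ~~ odd (findex g r y).
Proof.
move=> g_inj ev ry; rewrite -{1}(iter_findex ry) -iterS.
have := findex_max ry; set k := findex _ _ _.
rewrite leq_eqVlt => /orP[/eqP Ek|lt_k]; last by rewrite findex_iter.
have -> : iter k.+1 g r = r by rewrite Ek iter_order.
by rewrite findex0 -[~~ odd k]/(odd k.+1) Ek (negbTE ev).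
Qed.

Section TwoInvolutions.

Variables (T : finType) (a b : T -> T).
Hypotheses (aK : involutive a) (bK : involutive b).
Hypotheses (a_neq : forall x, a x != x) (b_neq : forall x, b x != x).

Let f x := b (a x).
Let e := [rel u v | (v == a u) || (v == b u)].

Let f_inj : injective f.
Proof. by move=> x y /(inv_inj bK)/(inv_inj aK). Qed.

(* [f^-1 = a f a], so [f^(k+2) x = a x] gives [f^k (f x) = a (f x)]. *)
Lemma iter_comp_involutions_neq k x : iter k f x != a x.
Proof.
suff [] : (forall x, iter k f x != a x) /\ (forall x, iter k.+1 f x != a x).
  by [].
elim: k => [|k [IHk IHk1]]; first by split=> y; rewrite /= ?b_neq // eq_sym.
split=> // y; apply: contra (IHk (f y)) => /eqP Ey.
by rewrite -iterSr; apply/eqP/f_inj; rewrite -iterS Ey /f aK bK.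
Qed.

Lemma fconnect_comp_involutions x : fconnect f x (a x) = false.
Proof.
by apply/negP => /iter_findex/eqP; rewrite (negbTE (iter_comp_involutions_neq _ _)).
Qed.

Let fconnect_b r y : fconnect f r (b y) = fconnect f r (a y).
Proof. by rewrite -[in b y](aK y) -[b _]/(f _) -same_fconnect1_r. Qed.

Let fconnect_ab r y : fconnect f r (a (b y)) = fconnect f r y.
Proof. by rewrite (same_fconnect1_r f_inj) /f aK bK. Qed.

(** Both [a] and [b] exchange the [f]-orbit of [r] with its mirror image under [a], so their union
    is closed under the two involutions. *)
Lemma connect_involutions r y :
  connect e r y = fconnect f r y || fconnect f r (a y).
Proof.
have fe u v : fconnect f u v -> connect e u v.
  apply: connect_sub => {}u {}v /eqP <-.
  apply: (@connect_trans _ _ (a u)); apply: connect1; rewrite /= ?eqxx //.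
  by rewrite orbT.
apply/idP/orP => [|[/fe //|/fe ray]].
  move=> ery; apply/orP; set S := [pred z | fconnect f r z || fconnect f r (a z)].
  have clS : closed e S.
    move=> u v /= /orP[]/eqP->; rewrite !inE ?aK 1?orbC //.
    by rewrite fconnect_b fconnect_ab.
  by have := closed_connect clS ery; rewrite !inE connect0 => <-.
by apply: connect_trans ray (connect1 _); rewrite /= aK eqxx.
Qed.

Lemma fconnect_exclusive r y : fconnect f r y -> fconnect f r (a y) = false.
Proof.
rewrite (fconnect_sym f_inj) => yr; apply/negP => /(connect_trans yr).
by rewrite fconnect_comp_involutions.
Qed.

(** The orbit and its mirror image are disjoint and [a] is a bijection between them. *)
Lemma card_connect_involutions r : #|connect e r| = (order f r).*2.
Proof.
pose O := [set y | fconnect f r y].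
have cO : #|O| = order f r by rewrite /order; apply: eq_card => y; rewrite inE.
have -> : #|connect e r| = #|O :|: (a @^-1: O)|.
  by apply: eq_card => y; rewrite !inE -connect_involutions.
rewrite cardsU (_ : O :&: _ = set0); last first.
  apply/setP => y; rewrite !inE.
  by have [/fconnect_exclusive->|] := boolP (fconnect f r y).
rewrite cards0 subn0 on_card_preimset ?cO ?addnn //.
exact: onW_bij (inv_bij aK).
Qed.

Lemma involutions_two_colouring :
    (forall x, ~~ odd #|connect e x|./2) ->
  exists c : T -> bool, (forall x, c (a x) = ~~ c x) /\ (forall x, c (b x) = c x).
Proof.
move=> ev; have e_sym : connect_sym e.
  apply: sym_connect_sym => x y /=; congr (_ || _); apply/eqP/eqP => ->.
  - by rewrite aK.
  - by rewrite aK.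
  - by rewrite bK.
  - by rewrite bK.
pose rt := root e.
have rta x : rt (a x) = rt x.
  by apply/eqP; rewrite (root_connect e_sym) e_sym connect1 //= eqxx.
have rtb x : rt (b x) = rt x.
  by apply/eqP; rewrite (root_connect e_sym) e_sym connect1 //= eqxx orbT.
have rtP x : fconnect f (rt x) (a x) = ~~ fconnect f (rt x) x.
  have : connect e (rt x) x by rewrite e_sym connect_root.
  rewrite connect_involutions.
  by have [/fconnect_exclusive->|_ /= ->] := boolP (fconnect f _ x).
have odd_f r y : fconnect f r y -> odd (findex f r (f y)) = ~~ odd (findex f r y).
  apply: odd_findex_next => //.
  by have := ev r; rewrite card_connect_involutions doubleK.
(* Exactly one of [x] and [b x] lies on the [f]-orbit of the root. It represents the arc, and the
   parity of its position is the colour. Crossing an end moves to an arc adjacent in this orbit. *)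
pose c x := let r := rt x in odd (findex f r (if fconnect f r x then x else b x)).
exists c; split=> x; rewrite /c ?rta ?rtb.
  rewrite rtP; have [rx|rx] /= := boolP (fconnect f (rt x) x).
    by rewrite -odd_f.
  have -> : b x = f (a x) by rewrite /f aK.
  by rewrite odd_f ?rtP // negbK.
by rewrite fconnect_b rtP bK; case: (fconnect f _ x).
Qed.

End TwoInvolutions.

Lemma acrossK (E : finType) : involutive (@across E).
Proof. by case=> h s; rewrite /across /= negbK. Qed.

Lemma across_neq (E : finType) (x : corner E) : across x != x.
Proof. by case: x => h [] ; rewrite /across xpair_eqE andbF. Qed.

Lemma card_vertex_corners (G : ribbon_graph) (x : corner (edge G)) :
  #|connect [rel u v | (v == across u) || (v == Defs.arc u)] x|
    = (degree (attach x.1)).*2.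
Proof.
rewrite -muln2 -card_bool -cardsT /degree -cardsX; apply: eq_card => y.
rewrite (_ : (y \in _ x) = (attach x.1 == attach y.1)); last first.
  exact: (@attach_arc G x y).
by rewrite !inE andbT eq_sym.
Qed.

Lemma eulerian_corner_colouring (G : ribbon_graph) : eulerian G ->
  exists c : corner (edge G) -> bool,
    (forall x, c (across x) = ~~ c x) /\ (forall x, c (Defs.arc x) = c x).
Proof.
move=> evG; apply: involutions_two_colouring (@acrossK _) (@arcK G)
  (@across_neq _) (@arc_neq G) _ => x.
by rewrite card_vertex_corners doubleK.
Qed.

Lemma checkerboard_of_corner_colouring (G : ribbon_graph)
    (c : corner (edge G) -> bool) :
    (forall x, c (across x) = ~~ c x) -> (forall x, c (Defs.arc x) = c x) ->
    (forall x, c (along x) = c x) ->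
  checkerboard_colourable G.
Proof.
move=> c_across c_arc c_along.
have c_const x y : connect (@boundary_step G) x y -> c x = c y.
  move=> xy; apply: (closed_connect (a := c)) xy => u v.
  by case/orP=> /eqP->; rewrite -!topredE /= ?c_along ?c_arc.
(* As [c] is constant on a boundary circle, the existential reads off its common value. Faces of
   isolated vertices border no edge, so their colour is arbitrary. *)
pose colour (F : face G) :=
  if F is inl C then [exists x in val C, c x] else false.
exists colour => e.
have colourE s : colour (side_face e s) = c (e, false, s).
  apply/exists_inP/idP => [[y]|cx].
    by rewrite !inE /= => /c_const ->.
  by exists (e, false, s); rewrite // !inE connect0.
by rewrite !colourE -[(e, false, true)]/(across (e, false, false)) c_across; case: (c _).
Qed.

Theorem theorem2 (G : ribbon_graph) (G_eulerian : eulerian G) :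
  exists I : {set edge G}, checkerboard_colourable (partial_petrial I).
Proof.
have [c [c_across c_arc]] := eulerian_corner_colouring G_eulerian.
have cE h s : c (h, s) = c (h, false) (+) s.
  by case: s; rewrite ?addbF // -[(h, true)]/(across (h, false)) c_across addbT.
(* By [cE], the far corner of the segment from [(e, false, false)] has colour
   [c (e, true, false) (+) twist e]; [I] collects the edges where the two colours differ. *)
pose I := [set e | twist e (+) c (e, false, false) (+) c (e, true, false)].
have c_along (e : edge G) (i s : bool) :
    c (e, ~~ i, s (+) (twist e (+) (e \in I))) = c (e, i, s).
  rewrite inE cE [in RHS]cE.
  by case: i => /=; case: (twist e); case: (c (e, true, false));
    case: (c (e, false, false)); case: s.
(* The partial Petrial keeps all corners and arcs, so only the condition on [along] has to be
   checked anew. *)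
exists I; apply: (@checkerboard_of_corner_colouring (partial_petrial I) c) => //.
by case=> [[e i] s]; apply: c_along.
Qed.
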